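(* Let $p > 2$ be a prime and let $R$ be a finite commutative local ring of order $p^{nr}$, with $n,r$ positive integers, such that $F=R/J(R)$ is a field with $p^r$ elements. Let $c \in H(R)$ and denote $\overline{c}=c+J(H(R))\in H(R)/J(H(R))$. Then $$\varphi_{2}(H(R), c)= \begin{cases} p^{(4n-3)r}(p^{3r} - 3 p^{2r} + 6), & \text{if } \overline{c}=0, \\ p^{(4n-3)r}(p^{3r} - 2 p^{2r} - p^r + 3), & \text{if } \overline{c}=1, \\ p^{4(n-1)r}(p^{4r} -4 p^{3r} + 5 p^{2r} - 4 p^r + 4), & \text{if } \overline{c}\neq 0,1 \text{ is an idempotent}, \\ p^{(4n-3)r}(p^{3r} - 4 p^{2r} + 3p^r + 2), & \text{if } \overline{c}\neq 0 \text{ is nilpotent}. \end{cases}$$ If $c$ is invertible, then $\varphi_{2}(H(R), c) \leq p^{(4n-3)r}(p^{3r} - 2 p^{2r} - p^r + 3)$. Furthermore, if $p^r \geq 9$, then $\varphi_{2}(H(R), c) \geq p^{(4n-1)r}(p^{r} - 8)$, and if additionally $\overline{c}^2=\lambda \overline{c}$ for some $\lambda \in F$ with $\lambda\neq 0,1$, then $$\varphi_{2}(H(R), c) \leq \frac{p^{(4n-3)r}}{p^r-8}\,(p^{4r} - 4p^{3r} + 5p^{2r} - 4p^r + 4).$$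
   Context: All rings are associative with identity; $J(S)$ is the Jacobson radical of a ring $S$. For a ring $S$, $S^{*}$ denotes its group of units, and $u\in S$ is an exceptional unit if $u\in S^*$ and $1-u\in S^*$; $S^{**}$ is the set of exceptional units of $S$. For $c\in S$, $\varphi_2(S,c)=|\{(x_1,x_2)\in (S^{**})^2 : x_1+x_2=c\}|$. For a commutative ring $R$, the quaternion ring is $H(R)=R\oplus R\mathbf{i}\oplus R\mathbf{j}\oplus R\mathbf{k}$ with componentwise addition and multiplication determined by $\mathbf{i}^2=\mathbf{j}^2=\mathbf{k}^2=\mathbf{i}\mathbf{j}\mathbf{k}=-1$, $\mathbf{i}\mathbf{j}=-\mathbf{j}\mathbf{i}$, where $\mathbf{i},\mathbf{j},\mathbf{k}$ commute with the elements of $R$. The ring $H(R)/J(H(R))$ is regarded as an $F$-algebra, $F=R/J(R)$, via $(a+J(R))\cdot(x+J(H(R)))=ax+J(H(R))$ for $a\in R$, $x\in H(R)$. *)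

(* Defs.v *)
From HB Require Import structures.
From mathcomp Require Import all_boot all_order all_algebra.
From mathcomp Require Import ring.

Set Implicit Arguments.
Unset Strict Implicit.
Unset Printing Implicit Defensive.

Import GRing.Theory.
Local Open Scope ring_scope.
Local Open Scope quotient_scope.

Record quaternion (R : Type) : Type :=
  Quaternion { quat_re : R; quat_i : R; quat_j : R; quat_k : R }.

Definition tuple_of_quat R (x : quaternion R) : R * R * R * R :=
  (quat_re x, quat_i x, quat_j x, quat_k x).
Definition quat_of_tuple R (t : R * R * R * R) : quaternion R :=
  Quaternion t.1.1.1 t.1.1.2 t.1.2 t.2.
Lemma tuple_of_quatK R : cancel (@tuple_of_quat R) (@quat_of_tuple R).
Proof. by case. Qed.

HB.instance Definition _ (R : eqType) :=
  Equality.copy (quaternion R) (can_type (@tuple_of_quatK R)).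
HB.instance Definition _ (R : choiceType) :=
  Choice.copy (quaternion R) (can_type (@tuple_of_quatK R)).
HB.instance Definition _ (R : countType) :=
  Countable.copy (quaternion R) (can_type (@tuple_of_quatK R)).
HB.instance Definition _ (R : finType) :=
  Finite.copy (quaternion R) (can_type (@tuple_of_quatK R)).

Section QuaternionRing.
Variable R : comNzRingType.
Implicit Types x y z : quaternion R.

Definition quat_zero : quaternion R := Quaternion 0 0 0 0.
Definition quat_one : quaternion R := Quaternion 1 0 0 0.
Definition quat_opp x :=
  Quaternion (- quat_re x) (- quat_i x) (- quat_j x) (- quat_k x).
Definition quat_add x y :=
  Quaternion (quat_re x + quat_re y) (quat_i x + quat_i y)
             (quat_j x + quat_j y) (quat_k x + quat_k y).
Definition quat_mul x y :=
  let: Quaternion a b c d := x in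
  let: Quaternion a' b' c' d' := y in
  Quaternion (a * a' - b * b' - c * c' - d * d')
             (a * b' + b * a' + c * d' - d * c')
             (a * c' - b * d' + c * a' + d * b')
             (a * d' + b * c' - c * b' + d * a').
Definition quat_scale (a : R) x :=
  Quaternion (a * quat_re x) (a * quat_i x) (a * quat_j x) (a * quat_k x).

Lemma quat_addA : associative quat_add.
Proof. by move=> [????] [????] [????]; congr Quaternion; rewrite /= addrA. Qed.
Lemma quat_addC : commutative quat_add.
Proof. by move=> [????] [????]; congr Quaternion; rewrite /= addrC. Qed.
Lemma quat_add0 : left_id quat_zero quat_add.
Proof. by move=> [????]; congr Quaternion; rewrite /= add0r. Qed.
Lemma quat_addN : left_inverse quat_zero quat_opp quat_add.
Proof. by move=> [????]; congr Quaternion; rewrite /= addNr. Qed.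
HB.instance Definition _ := GRing.isZmodule.Build (quaternion R)
  quat_addA quat_addC quat_add0 quat_addN.

Lemma quat_mulA : associative quat_mul.
Proof. by move=> [????] [????] [????]; congr Quaternion; ring. Qed.
Lemma quat_mul1 : left_id quat_one quat_mul.
Proof. by move=> [????]; congr Quaternion; ring. Qed.
Lemma quat_mulr1 : right_id quat_one quat_mul.
Proof. by move=> [????]; congr Quaternion; ring. Qed.
Lemma quat_mulDl : left_distributive quat_mul +%R.
Proof. by move=> [????] [????] [????]; congr Quaternion; rewrite /=; ring. Qed.
Lemma quat_mulDr : right_distributive quat_mul +%R.
Proof. by move=> [????] [????] [????]; congr Quaternion; rewrite /=; ring. Qed.
Lemma quat_1neq0 : quat_one != 0.
Proof. by apply/eqP => -[/eqP]; rewrite oner_eq0. Qed.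
HB.instance Definition _ := GRing.Zmodule_isNzRing.Build (quaternion R)
  quat_mulA quat_mul1 quat_mulr1 quat_mulDl quat_mulDr quat_1neq0.

Lemma quat_scaleA a b x : quat_scale a (quat_scale b x) = quat_scale (a * b) x.
Proof. by congr Quaternion; rewrite /= mulrA. Qed.
Lemma quat_scale1 : left_id 1 quat_scale.
Proof. by move=> [????]; congr Quaternion; rewrite /= mul1r. Qed.
Lemma quat_scaleDr : right_distributive quat_scale +%R.
Proof. by move=> a x y; congr Quaternion; rewrite /= mulrDr. Qed.
Lemma quat_scaleDl x : {morph quat_scale^~ x : a b / a + b}.
Proof. by move=> a b; congr Quaternion; rewrite /= mulrDl. Qed.
HB.instance Definition _ := GRing.Zmodule_isLmodule.Build R (quaternion R)
  quat_scaleA quat_scale1 quat_scaleDr quat_scaleDl.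

Lemma quat_scaleAl (a : R) x y : a *: (x * y) = (a *: x) * y.
Proof. by case: x y => [????] [????]; congr Quaternion; rewrite /=; ring. Qed.
HB.instance Definition _ :=
  GRing.Lmodule_isLalgebra.Build R (quaternion R) quat_scaleAl.

Lemma quat_scaleAr (a : R) x y : a *: (x * y) = x * (a *: y).
Proof. by case: x y => [????] [????]; congr Quaternion; rewrite /=; ring. Qed.
HB.instance Definition _ :=
  GRing.Lalgebra_isAlgebra.Build R (quaternion R) quat_scaleAr.

Definition quatI : quaternion R := Quaternion 0 1 0 0.
Definition quatJ : quaternion R := Quaternion 0 0 1 0.
Definition quatK : quaternion R := Quaternion 0 0 0 1.

Lemma quat_basis a b c d :
  Quaternion a b c d = a%:A + b *: quatI + c *: quatJ + d *: quatK.
Proof. by congr Quaternion; rewrite /=; ring. Qed.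
Lemma quat_relations :
  [/\ quatI ^+ 2 = -1, quatJ ^+ 2 = -1, quatK ^+ 2 = -1,
      quatI * quatJ * quatK = -1 & quatI * quatJ = - (quatJ * quatI)].
Proof. by split; congr Quaternion; rewrite /=; ring. Qed.

Definition quat_conj x :=
  Quaternion (quat_re x) (- quat_i x) (- quat_j x) (- quat_k x).
Definition quat_norm x : R :=
  quat_re x ^+ 2 + quat_i x ^+ 2 + quat_j x ^+ 2 + quat_k x ^+ 2.

Lemma quat_conj_mul x : quat_conj x * x = (quat_norm x)%:A.
Proof. by case: x => [????]; congr Quaternion; rewrite /quat_norm /=; ring. Qed.
End QuaternionRing.

Arguments quatI {R}.
Arguments quatJ {R}.
Arguments quatK {R}.

HB.instance Definition _ (R : finComNzRingType) := Finite.on (quaternion R).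

(* [FinRing.isNzRing] makes [GRing.unit] the set of two-sided units *)
HB.instance Definition _ (R : finComNzRingType) :=
  FinRing.isNzRing.Build (quaternion R).

Section Jacobson.
Variable S : finNzRingType.
Implicit Types M I : {set S}.

(* [idealr_closed] is the library predicate for proper left ideals *)
Definition maximal_left_ideal M : Prop :=
  idealr_closed M /\ forall I, idealr_closed I -> M \subset I -> I = M.

Definition left_idealb I : bool :=
  [&& 0 \in I, 1 \notin I
    & [forall a, forall u in I, forall v in I, a * u + v \in I]].

Lemma left_idealP I : reflect (idealr_closed I) (left_idealb I).
Proof.
apply: (iffP and3P) => -[I0 I1 cI]; split=> //.
  by move=> a u v uI vI; move/forallP/(_ a)/forall_inP/(_ u uI)/forall_inP: cI; apply.
by apply/forallP=> a; apply/forall_inP=> u uI; apply/forall_inP=> v vI; apply: cI.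
Qed.

Lemma maximal_left_idealP M :
  reflect (maximal_left_ideal M) (maxset left_idealb M).
Proof.
apply: (iffP maxsetP) => -[/left_idealP idM maxM]; split=> //.
  by move=> I /left_idealP idI; apply: maxM.
by move=> I /left_idealP idI; apply: maxM.
Qed.

Definition jacobson : {pred S} :=
  fun x => [forall M : {set S}, maxset left_idealb M ==> (x \in M)].

Lemma jacobsonP x :
  reflect (forall M, maximal_left_ideal M -> x \in M) (x \in jacobson).
Proof.
apply: (iffP forallP) => [Jx M /maximal_left_idealP maxM|Jx M].
  exact: (implyP (Jx M)).
by apply/implyP=> /maximal_left_idealP /Jx.
Qed.

Lemma maximal_left_ideal_exists I : idealr_closed I ->
  {M | maximal_left_ideal M & I \subset M}.
Proof.
move=> /left_idealP /maxset_exists[M maxM sIM].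
by exists M => //; apply/maximal_left_idealP.
Qed.

Lemma ideal1_closed : idealr_closed [set 0 : S].
Proof.
split=> [||a u v]; rewrite !inE ?eqxx ?oner_eq0 //.
by move=> /eqP-> /eqP->; rewrite mulr0 addr0.
Qed.

Lemma jacobson_closed : idealr_closed jacobson.
Proof.
split=> [||a u v /jacobsonP Ju /jacobsonP Jv].
- by apply/jacobsonP=> M [[]].
- have [M maxM _] := maximal_left_ideal_exists ideal1_closed.
  by apply/jacobsonP=> /(_ M maxM); case: maxM => -[_ /negbTE->].
- apply/jacobsonP=> M maxM; have [[_ _ cM] _] := maxM.
  by rewrite cM ?Ju ?Jv.
Qed.
HB.instance Definition _ := isIdealr.Build S jacobson jacobson_closed.

Lemma maximal_left_ideal_unit M x : maximal_left_ideal M -> x \notin M ->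
  exists s, 1 - s * x \in M.
Proof.
move=> [[M0 M1 cM] maxM] xM.
have cMl a u : u \in M -> a * u \in M by move=> uM; rewrite -[_ * _]addr0 cM.
pose I := [set y | [exists s, y - s * x \in M]].
have sMI : M \subset I.
  by apply/subsetP=> y yM; rewrite inE; apply/existsP; exists 0; rewrite mul0r subr0.
have xI : x \in I by rewrite inE; apply/existsP; exists 1; rewrite mul1r subrr.
have [|I1] := boolP (1 \in I); first by rewrite inE => /existsP.
case/negP: xM; rewrite -(maxM I) //; split=> [||a u v] //; first exact: (subsetP sMI).
rewrite !inE => /existsP[s us] /existsP[t vt].
apply/existsP; exists (a * s + t).
have -> : a * u + v - (a * s + t) * x = a * (u - s * x) + (v - t * x).
  by rewrite mulrDl -mulrA opprD mulrBr addrACA.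
exact: cM.
Qed.

Lemma jacobsonMr x a : x \in jacobson -> x * a \in jacobson.
Proof.
move=> /jacobsonP Jx; apply/jacobsonP=> M maxM.
have [[M0 M1 cM] _] := maxM.
have cMl b u : u \in M -> b * u \in M by move=> uM; rewrite -[_ * _]addr0 cM.
have [aM|aM] := boolP (a \in M); first exact: cMl.
pose N := [set y | y * a \in M].
suff /Jx : maximal_left_ideal N by rewrite inE.
split=> [|I [I0 I1 cI] sNI].
  split; rewrite ?inE ?mul0r ?mul1r // => b u v.
  by rewrite !inE mulrDl -mulrA; apply: cM.
apply/eqP; rewrite eqEsubset sNI andbT; apply/subsetP=> y yI.
apply/negPn/negP=> yN; rewrite inE in yN.
have [s sM] := maximal_left_ideal_unit maxM yN.
have : 1 - (a * s) * y \in N.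
  have -> : 1 - a * s * y = 1 - a * (s * y) by rewrite mulrA.
  rewrite inE mulrBl mul1r -!mulrA -[X in X - _]mulr1 -mulrBr.
  exact: cMl.
by move/(subsetP sNI)/(cI (a * s) y _ yI); rewrite addrC subrK (negbTE I1).
Qed.

End Jacobson.

Arguments jacobson S : clear implicits.

(* S / J(S), rebuilt because [{ideal_quot _}] only covers commutative rings *)

Section JacobsonQuotient.
Variable S : finNzRingType.

Definition jquot : Type := Quotient.quot (jacobson S).
HB.instance Definition _ := EqQuotient.copy jquot (Quotient.quot (jacobson S)).
HB.instance Definition _ := Choice.copy jquot (Quotient.quot (jacobson S)).
HB.instance Definition _ := GRing.Zmodule.copy jquot (Quotient.quot (jacobson S)).
HB.instance Definition _ : isCountable jquot := CanIsCountable (@reprK _ jquot).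
HB.instance Definition _ : isFinite jquot := CanIsFinite (@reprK _ jquot).

Lemma jquotE (x y : S) :
  (x - y \in jacobson S) = (\pi_jquot x == \pi_jquot y).
Proof. exact: Quotient.idealrBE. Qed.

Lemma jquotD (x y : S) : \pi_jquot (x + y) = \pi_jquot x + \pi_jquot y.
Proof. exact: (@Quotient.pi_add S (jacobson S)). Qed.

Definition jquot_one : jquot := \pi_jquot (1 : S).
Definition jquot_mul := lift_op2 jquot (@GRing.mul S).

Lemma jquot_piM (x y : S) :
  jquot_mul (\pi x) (\pi y) = \pi_jquot (x * y).
Proof.
unlock jquot_mul; apply/eqP; rewrite -jquotE.
set x' := repr _; set y' := repr _.
have Jx : x' - x \in jacobson S by rewrite jquotE reprK.
have Jy : y' - y \in jacobson S by rewrite jquotE reprK.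
have -> : x' * y' - x * y = (x' - x) * y' + x * (y' - y).
  by rewrite mulrBl mulrBr addrA subrK.
by rewrite rpredD ?(jacobsonMr _ Jx) ?(idealMr _ Jy).
Qed.

Lemma jquotP (x : jquot) : exists y : S, x = \pi_jquot y.
Proof. by exists (repr x); rewrite reprK. Qed.

Lemma jquot_mulA : associative jquot_mul.
Proof.
move=> x y z; have [[a ->] [b ->] [c ->]] := And3 (jquotP x) (jquotP y) (jquotP z).
by rewrite !jquot_piM mulrA.
Qed.
Lemma jquot_mul1 : left_id jquot_one jquot_mul.
Proof. by move=> x; have [a ->] := jquotP x; rewrite jquot_piM mul1r. Qed.
Lemma jquot_mulr1 : right_id jquot_one jquot_mul.
Proof. by move=> x; have [a ->] := jquotP x; rewrite jquot_piM mulr1. Qed.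
Lemma jquot_mulDl : left_distributive jquot_mul +%R.
Proof.
move=> x y z; have [[a ->] [b ->] [c ->]] := And3 (jquotP x) (jquotP y) (jquotP z).
by rewrite -jquotD !jquot_piM -jquotD mulrDl.
Qed.
Lemma jquot_mulDr : right_distributive jquot_mul +%R.
Proof.
move=> x y z; have [[a ->] [b ->] [c ->]] := And3 (jquotP x) (jquotP y) (jquotP z).
by rewrite -jquotD !jquot_piM -jquotD mulrDr.
Qed.
Lemma jquot_1neq0 : jquot_one != 0.
Proof.
have <- : \pi_jquot 0 = 0 by exact: (@pi_zeror _ _ _ _ _ (Quotient.quot (jacobson S))).
by rewrite -jquotE subr0 idealr1.
Qed.
HB.instance Definition _ := GRing.Zmodule_isNzRing.Build jquot
  jquot_mulA jquot_mul1 jquot_mulr1 jquot_mulDl jquot_mulDr jquot_1neq0.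
HB.instance Definition _ := FinRing.isNzRing.Build jquot.

Lemma pi_jquot_is_zmod_morphism : zmod_morphism \pi_jquot.
Proof. by move=> x y; apply: (addIr (\pi y)); rewrite -jquotD !subrK. Qed.
Lemma pi_jquot_is_monoid_morphism : monoid_morphism \pi_jquot.
Proof. by split=> [|x y] //; rewrite -jquot_piM. Qed.

End JacobsonQuotient.

Definition jproj (S : finNzRingType) (x : S) : jquot S := \pi x.
HB.instance Definition _ (S : finNzRingType) :=
  GRing.isZmodMorphism.Build S (jquot S) (@jproj S) (@pi_jquot_is_zmod_morphism S).
HB.instance Definition _ (S : finNzRingType) :=
  GRing.isMonoidMorphism.Build S (jquot S) (@jproj S) (@pi_jquot_is_monoid_morphism S).

Lemma jprojP (S : finNzRingType) (x : jquot S) : exists y, x = jproj y.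
Proof. exact: jquotP. Qed.

Lemma jproj_eq (S : finNzRingType) (x y : S) :
  (jproj x == jproj y) = (x - y \in jacobson S).
Proof. by rewrite jquotE. Qed.

Section ResidueAlgebra.
Variable R : finComNzRingType.
Local Notation H := (quaternion R).

Lemma jquot_mulC : @commutative (jquot R) (jquot R) *%R.
Proof.
move=> x y; have [[a ->] [b ->]] := conj (jprojP x) (jprojP y).
by rewrite -!rmorphM mulrC.
Qed.
HB.instance Definition _ :=
  GRing.PzRing_hasCommutativeMul.Build (jquot R) jquot_mulC.

Lemma jacobson_unit (a : R) :
  a \in jacobson R -> exists b, b * (1 - a) = 1.
Proof.
move=> Ja; pose I := [set b * (1 - a) | b : R].
have memI b : b * (1 - a) \in I by apply/imsetP; exists b.
have [/imsetP[b _ E1]|I1] := boolP (1 \in I); first by exists b; rewrite -E1.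
have /maximal_left_ideal_exists[M maxM sIM] : idealr_closed I.
  split=> //; first by rewrite -(mul0r (1 - a)).
  move=> c _ _ /imsetP[u _ ->] /imsetP[v _ ->].
  by rewrite mulrA -mulrDl.
have [[_ M1 cM] _] := maxM; case/negP: M1.
have aM := jacobsonP _ Ja M maxM.
by have := cM 1 _ _ (subsetP sIM _ (memI 1)) aM; rewrite !mul1r subrK.
Qed.

Lemma jacobson_quaternion (a : R) (x : H) :
  a \in jacobson R -> a *: x \in jacobson H.
Proof.
move=> Ja; rewrite -mulr_algl jacobsonMr //; apply/jacobsonP=> M maxM.
have [//|aM] := boolP (a%:A \in M).
have [s sM] := maximal_left_ideal_unit maxM aM.
have [[_ M1 cM] _] := maxM.
have cMl b u : u \in M -> b * u \in M.
  by case: maxM => -[M0 _ _] _ uM; rewrite -[_ * _]addr0 cM.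
have [t Et] : exists t, quat_norm (1 - s * a%:A) = 1 - a * t.
  case: s {sM} => [s0 s1 s2 s3].
  exists (s0 *+ 2 - a * (s0 ^+ 2 + s1 ^+ 2 + s2 ^+ 2 + s3 ^+ 2)).
  by rewrite mulr_algr /quat_norm /=; ring.
have [b Eb] := jacobson_unit (jacobsonMr t Ja).
case/negP: M1.
have -> : 1 = b%:A * (quat_conj (1 - s * a%:A) * (1 - s * a%:A)).
  by rewrite quat_conj_mul Et mulr_algl scalerA Eb scale1r.
by rewrite !cMl.
Qed.

(* Independent of the representatives by [jscale_proj] *)
Definition jscale_def (l : jquot R) (x : jquot H) : jquot H :=
  jproj (repr l *: repr x).
Definition jscale := locked jscale_def.

Lemma jscale_proj (a : R) (x : H) : jscale (jproj a) (jproj x) = jproj (a *: x).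
Proof.
rewrite /jscale -lock; apply/eqP; rewrite jproj_eq.
set a' := repr _; set x' := repr _.
have Ja : a' - a \in jacobson R by rewrite jquotE reprK.
have Jx : x' - x \in jacobson H by rewrite jquotE reprK.
have -> : a' *: x' - a *: x = (a' - a) *: x' + a%:A * (x' - x).
  by rewrite mulr_algl scalerBl scalerBr addrA subrK.
by rewrite rpredD ?(jacobson_quaternion _ Ja) ?(idealMr _ Jx).
Qed.

Lemma jscaleA l m x : jscale l (jscale m x) = jscale (l * m) x.
Proof.
have [[a ->] [b ->] [y ->]] := And3 (jprojP l) (jprojP m) (jprojP x).
by rewrite -rmorphM !jscale_proj scalerA.
Qed.
Lemma jscale1 : left_id 1 jscale.
Proof.
move=> x; have [y ->] := jprojP x.
by rewrite -(rmorph1 (@jproj R)) jscale_proj scale1r.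
Qed.
Lemma jscaleDr : right_distributive jscale +%R.
Proof.
move=> l x y; have [[a ->] [b ->] [c ->]] := And3 (jprojP l) (jprojP x) (jprojP y).
by rewrite -raddfD !jscale_proj scalerDr raddfD.
Qed.
Lemma jscaleDl x : {morph jscale^~ x : l m / l + m}.
Proof.
move=> l m; have [[a ->] [b ->] [y ->]] := And3 (jprojP l) (jprojP m) (jprojP x).
by rewrite -raddfD !jscale_proj scalerDl raddfD.
Qed.
HB.instance Definition _ := GRing.Zmodule_isLmodule.Build (jquot R) (jquot H)
  jscaleA jscale1 jscaleDr jscaleDl.

Lemma jscaleAl (l : jquot R) (x y : jquot H) : l *: (x * y) = (l *: x) * y.
Proof.
have [[a ->] [b ->] [c ->]] := And3 (jprojP l) (jprojP x) (jprojP y).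
by rewrite -rmorphM /GRing.scale /= !jscale_proj -rmorphM scalerAl.
Qed.
HB.instance Definition _ :=
  GRing.Lmodule_isLalgebra.Build (jquot R) (jquot H) jscaleAl.

Lemma jscaleAr (l : jquot R) (x y : jquot H) : l *: (x * y) = x * (l *: y).
Proof.
have [[a ->] [b ->] [c ->]] := And3 (jprojP l) (jprojP x) (jprojP y).
by rewrite -rmorphM /GRing.scale /= !jscale_proj -rmorphM scalerAr.
Qed.
HB.instance Definition _ :=
  GRing.Lalgebra_isAlgebra.Build (jquot R) (jquot H) jscaleAr.

Lemma jquot_scaleE (a : R) (x : H) : jproj a *: jproj x = jproj (a *: x).
Proof. exact: jscale_proj. Qed.

End ResidueAlgebra.

(* For commutative rings, left ideals are ideals *)
Definition local_ring (R : finComNzRingType) : Prop :=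
  exists! M : {set R}, maximal_left_ideal M.

Definition exceptional_unit (S : unitRingType) (u : S) : bool :=
  (u \is a GRing.unit) && (1 - u \is a GRing.unit).

Definition phi2 (S : finUnitRingType) (c : S) : nat :=
  #|[set x : S * S | [&& exceptional_unit x.1, exceptional_unit x.2
                       & x.1 + x.2 == c]]|.

(* Main.v *)
Require Import Defs.
From HB Require Import structures.
From mathcomp Require Import all_boot all_order all_algebra.
From mathcomp Require Import ring lra zify.

Set Implicit Arguments.
Unset Strict Implicit.
Unset Printing Implicit Defensive.

Import Order.TTheory GRing.Theory Num.Theory.
Local Open Scope ring_scope.

(* Let F = R/J(R) and q = #|F|. As q is odd, -1 is a sum of two squares in F,
   so H(F) is split and reduction gives a surjective ring morphism H(R) ->
   M_2(F) whose kernel is J(H(R)) and which detects units through the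
   determinant. All its fibres have the same size, so phi_2(H(R), c) is
   q^(4(n-1)) times the number of X in M_2(F) such that X, X - 1, X - C and X -
   (C - 1) are invertible, C being the image of c. This number depends only on
   the conjugacy class of C, and in each exact case C may be taken among 0, 1,
   E_11, E_12. The four points to avoid are then upper triangular, say with
   entries a_i, b_i, d_i, and det (X - A_i) = (x - a_i)(t - d_i) - (y - b_i) z
   for X = (x, y; z, t): for z = 0 this constrains x and t separately, and for
   z != 0 it says that w = y z avoids (x - a_i)(t - d_i) + b_i z. The upper
   bound for units keeps only the conditions on X and X - 1, which amounts to C
   = 1; the lower bound is the union bound; and the last bound already holds
   for q^4, the number of all X. *)

(** * Two-by-two matrices given by their entries *)

Lemma ord2P (k : 'I_2) : k = 0 \/ k = 1.
Proof. by case: k => -[|[|//]] lt; [left | right]; apply: val_inj. Qed.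

Section Matrices2.
Variable F : comNzRingType.

Definition mx2 (x y z t : F) : 'M[F]_2 :=
  \matrix_(i, j) if i == 0 then if j == 0 then x else y
                 else if j == 0 then z else t.

Lemma eq_mx2 (A B : 'M[F]_2) :
  A 0 0 = B 0 0 -> A 0 1 = B 0 1 -> A 1 0 = B 1 0 -> A 1 1 = B 1 1 -> A = B.
Proof.
move=> e00 e01 e10 e11; apply/matrixP=> i j.
by case: (ord2P i) => ->; case: (ord2P j) => ->.
Qed.

Lemma mx2_eta (X : 'M[F]_2) : mx2 (X 0 0) (X 0 1) (X 1 0) (X 1 1) = X.
Proof. by apply: eq_mx2; rewrite mxE. Qed.

Lemma det_mx2 x y z t : \det (mx2 x y z t) = x * t - y * z.
Proof.
rewrite (expand_det_row _ 0) !big_ord_recl big_ord0 /cofactor !det_mx11.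
by rewrite !mxE /= !expr0 /bump /= expr1; ring.
Qed.

Lemma mx2B x y z t x' y' z' t' :
  mx2 x y z t - mx2 x' y' z' t' = mx2 (x - x') (y - y') (z - z') (t - t').
Proof. by apply: eq_mx2; rewrite !mxE. Qed.

Lemma mx2M x y z t x' y' z' t' :
  mx2 x y z t *m mx2 x' y' z' t' =
  mx2 (x * x' + y * z') (x * y' + y * t') (z * x' + t * z') (z * y' + t * t').
Proof.
by apply: eq_mx2; rewrite !mxE !big_ord_recl big_ord0 addr0 !mxE.
Qed.

Lemma mx2_1 : 1 = mx2 1 0 0 1.
Proof. by apply: eq_mx2; rewrite !mxE. Qed.

Lemma mx2_0 : 0 = mx2 0 0 0 0.
Proof. by apply: eq_mx2; rewrite !mxE. Qed.
End Matrices2.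

(** * Counting the matrices that avoid a list of upper triangular ones *)

Lemma card_indicator (T : finType) (P : pred T) :
  #|[set x | P x]|%:R = \sum_x (P x)%:R :> rat.
Proof.
rewrite -sum1_card natr_sum big_mkcond; apply: eq_bigr => x _.
by rewrite inE; case: (P x).
Qed.

Section Counting.
Variable F : finFieldType.
Local Notation q := (#|F|%:R : rat).

(** The sum over y is innermost because, for fixed x, t and z, avoidance constrains y alone.
    Counting in [rat] keeps the later subtractions exact. *)
Lemma card_mx2 (P : pred 'M[F]_2) :
  #|[set X | P X]|%:R =
  \sum_x \sum_t \sum_z \sum_y (P (mx2 x y z t))%:R :> rat.
Proof.
rewrite card_indicator !pair_big /=.
pose f (u : F * F * F * F) := mx2 u.1.1.1 u.2 u.1.2 u.1.1.2.
pose g (X : 'M[F]_2) := (X 0 0, X 1 1, X 1 0, X 0 1).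
rewrite (reindex f) //; exists g => [[[[x t] z] y] _|X _]; last exact: mx2_eta.
by rewrite /f /g !mxE.
Qed.

Lemma sum_notin (s : seq F) :
  \sum_w (w \notin s)%:R = q - (size (undup s))%:R.
Proof.
rewrite -card_indicator cardsE.
have <- : #|[in s]| = size (undup s).
  rewrite cardE; apply/perm_size/uniq_perm; rewrite ?enum_uniq ?undup_uniq //.
  by move=> x; rewrite mem_enum mem_undup.
by rewrite -(cardC [in s]) natrD addrC addKr.
Qed.

Lemma sum_shift (a : F) (f : F -> rat) : \sum_w f (w + a) = \sum_w f w.
Proof. by rewrite [RHS](reindex_inj (addIr a)). Qed.

Lemma sum_delta (a : F) : \sum_w (w == a)%:R = 1 :> rat.
Proof.
by rewrite (bigD1 a) //= eqxx big1 ?addr0 // => w /negbTE->.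
Qed.

Lemma sum_cst (k : rat) : \sum_(w : F) k = q * k.
Proof. by rewrite sumr_const mulr_natl. Qed.

Definition avoids (s : seq 'M[F]_2) (X : 'M[F]_2) :=
  all (fun A => \det (X - A) != 0) s.

Definition upper (u : F * F * F) := mx2 u.1.1 u.1.2 0 u.2.

Lemma avoids_upper (s : seq (F * F * F)) x y z t :
  avoids (map upper s) (mx2 x y z t) =
  (y * z \notin [seq (x - u.1.1) * (t - u.2) + u.1.2 * z | u <- s]).
Proof.
elim: s => //= u s IH; rewrite inE negb_or -IH mx2B det_mx2.
congr (_ && _); rewrite -[in RHS]subr_eq0 -oppr_eq0; congr (_ != 0); ring.
Qed.

Lemma count_avoids_upper (s : seq (F * F * F)) :
  #|[set X | avoids (map upper s) X]|%:R =
  q * (q - (size (undup [seq u.1.1 | u <- s]))%:R)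
    * (q - (size (undup [seq u.2 | u <- s]))%:R)
  + \sum_x \sum_t \sum_(z | z != 0) \sum_w
     (w \notin [seq (x - u.1.1) * (t - u.2) + u.1.2 * z | u <- s])%:R.
Proof.
rewrite card_mx2 -!sum_notin -mulrA big_distrlr mulr_sumr -big_split /=.
apply: eq_bigr => x _; rewrite mulr_sumr -big_split /=; apply: eq_bigr => t _.
rewrite (bigD1 0) //=; congr (_ + _).
  rewrite -sum_cst; apply: eq_bigr => y _; rewrite avoids_upper mulr0.
  rewrite -natrM mulnb; congr (nat_of_bool _)%:R.
  elim: s => //= u s IH; rewrite !inE !negb_or IH mulr0 addr0 eq_sym mulf_eq0.
  by rewrite negb_or !subr_eq0 -!andbA; do !bool_congr.
apply: eq_bigr => z z0; rewrite [RHS](reindex_inj (mulIf z0)).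
by apply: eq_bigr => y _; rewrite avoids_upper.
Qed.
Lemma size_undup2 (a b : F) : (size (undup [:: a; b]))%:R = 2 - (a == b)%:R :> rat.
Proof. by rewrite /= inE; case: eqP => _ /=; ring. Qed.

(** Inclusion-exclusion: when all three entries are equal, the pairwise terms remove 3 instead of 2,
    and the last term restores 1. *)
Lemma size_undup3 (a b c : F) :
  (size (undup [:: a; b; c]))%:R =
  3 - (a == b)%:R - (a == c)%:R - (b == c)%:R + ((a == b) && (b == c))%:R :> rat.
Proof.
rewrite /= !inE.
have [-> /=|nab] := eqVneq a b; first by case: eqP => _ /=; ring.
have [<-|_] := eqVneq b c; last by case: eqP => _ /=; ring.
by rewrite (negbTE nab) /=; ring.
Qed.

Lemma sum_ne0 (f : F -> rat) : \sum_(z | z != 0) f z = \sum_z f z - f 0.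
Proof. by rewrite [in RHS](bigD1 0) //= (addrC (f 0)) addrK. Qed.

(** With b = 0 the values forbidden to w do not depend on z, whence the factor q - 1. Shifting w by
    x t removes the term common to all products (x - a)(t - d). *)
Lemma count_avoids_upper_diag (s : seq (F * F * F)) :
    all (fun u => u.1.2 == 0) s ->
  \sum_x \sum_t \sum_(z | z != 0) \sum_w
     (w \notin [seq (x - u.1.1) * (t - u.2) + u.1.2 * z | u <- s])%:R =
  (q - 1) * \sum_(x : F) \sum_(t : F)
     (q - (size (undup [seq u.1.1 * u.2 - x * u.2 - t * u.1.1 | u <- s]))%:R).
Proof.
move=> /allP s0; rewrite mulr_sumr; apply: eq_bigr => x _.
rewrite mulr_sumr; apply: eq_bigr => t _.
rewrite -sum_notin mulrBl mul1r -sum_cst sum_ne0.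
have E z :
    \sum_w (w \notin [seq (x - u.1.1) * (t - u.2) + u.1.2 * z | u <- s])%:R =
    \sum_w (w \notin [seq u.1.1 * u.2 - x * u.2 - t * u.1.1 | u <- s])%:R :> rat.
  rewrite -(sum_shift (x * t)); apply: eq_bigr => w _; congr (~~ _)%:R.
  apply/mapP/mapP => -[u us e]; exists u => //; have /eqP u0 := s0 u us.
    by rewrite -[w](addrK (x * t)) e u0; ring.
  by rewrite e u0; ring.
by congr (_ - _) => //; apply: eq_bigr.
Qed.

(** After the shift by x t the forbidden values are 0 and 1 - x - t, which coincide exactly on the
    line t = 1 - x. *)
Lemma count_avoids01 :
  #|[set X | avoids [:: 0; 1] X]|%:R = q * (q ^+ 3 - 2 * q ^+ 2 - q + 3).
Proof.
have -> : [:: 0; 1] = map upper [:: (0, 0, 0); (1, 0, 1)].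
  by rewrite mx2_0 mx2_1.
rewrite count_avoids_upper count_avoids_upper_diag; last by rewrite /= eqxx.
rewrite !size_undup2 /= ![0 == 1]eq_sym !oner_eq0 subr0.
under eq_bigr => x _.
  under eq_bigr => t _.
    rewrite size_undup2 /=.
    have -> : (0 * 0 - x * 0 - t * 0 == 1 * 1 - x * 1 - t * 1) = (t == 1 - x).
      by rewrite -subr_eq0 -[RHS]subr_eq0; congr (_ == _); ring.
    over.
  rewrite sumrB sum_cst sumrB sum_cst sum_delta; over.
rewrite sum_cst; ring.
Qed.

Hypothesis two_neq0 : 2 != 0 :> F.

(** The forbidden values are 0, 1 - x - t and 1 + x + t. Two of them meet on each of the parallel
    lines x + t = 1, -1, 0; all three never meet, as 2 is nonzero. *)
Lemma count_avoids_zero :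
  #|[set X | avoids [:: 0; 1; -1] X]|%:R = q * (q ^+ 3 - 3 * q ^+ 2 + 6).
Proof.
have neq1N1 : 1 != -1 :> F by rewrite -subr_eq0 opprK.
have -> : [:: 0; 1; -1] = map upper [:: (0, 0, 0); (1, 0, 1); (-1, 0, -1)].
  rewrite mx2_0; congr [:: _; _; _]; first exact: mx2_1.
  by apply: eq_mx2; rewrite !mxE ?oppr0.
rewrite count_avoids_upper count_avoids_upper_diag; last by rewrite /= eqxx.
rewrite !size_undup3 /= ![0 == _]eq_sym oppr_eq0 oner_eq0 (negbTE neq1N1) /=.
under eq_bigr => x _.
  under eq_bigr => t _.
    rewrite size_undup3 /=.
    have -> : (0 * 0 - x * 0 - t * 0 == 1 * 1 - x * 1 - t * 1) = (t == 1 - x).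
      by rewrite -subr_eq0 -[RHS]subr_eq0; congr (_ == _); ring.
    have -> : (0 * 0 - x * 0 - t * 0 == (-1) * (-1) - x * (-1) - t * (-1)) = (t == - 1 - x).
      by rewrite eq_sym -subr_eq0 -[RHS]subr_eq0; congr (_ == _); ring.
    have -> : (1 * 1 - x * 1 - t * 1 == (-1) * (-1) - x * (-1) - t * (-1)) = (t == - x).
      rewrite eq_sym -subr_eq0 -[RHS]subr_eq0 -(mulrI_eq0 (t - - x) (mulfI two_neq0)).
      by congr (_ == _); ring.
    have -> : (t == 1 - x) && (t == - x) = false.
      apply/negP=> /andP[/eqP-> /eqP e]; move: (oner_eq0 F).
      by rewrite -[1](subrK x) e addNr eqxx.
    over.
  rewrite !(sumrB, big_split) /= !sum_cst !sum_delta; over.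
rewrite sum_cst; ring.
Qed.

Lemma sum_neq (a : F) (f : F -> rat) :
  \sum_x (x != a)%:R * f x = \sum_x f x - f a.
Proof.
rewrite [in RHS](bigD1 a) //= (addrC (f a)) addrK [RHS]big_mkcond.
by apply: eq_bigr => x _; case: eqP => _ /=; rewrite ?mul1r ?mul0r.
Qed.

(** The forbidden values 0, 1 - x - t, -t and x have many possible coincidences, so the sum over w
    is moved outside: for fixed w the conditions on x and t are easy to count. *)
Lemma count_avoids_idempotent :
  #|[set X | avoids [:: 0; 1; mx2 1 0 0 0; mx2 1 0 0 0 - 1] X]|%:R =
  q ^+ 4 - 4 * q ^+ 3 + 5 * q ^+ 2 - 4 * q + 4.
Proof.
have neq1N1 : 1 != -1 :> F by rewrite -subr_eq0 opprK.
pose s : seq (F * F * F) := [:: (0, 0, 0); (1, 0, 1); (1, 0, 0); (0, 0, -1)].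
have -> : [:: 0; 1; mx2 1 0 0 0; mx2 1 0 0 0 - 1] = map upper s.
  rewrite mx2_0 mx2_1 mx2B; congr [:: _; _; _; _].
  by rewrite !subrr sub0r.
rewrite count_avoids_upper count_avoids_upper_diag; last by rewrite /= eqxx.
have -> : size (undup [seq u.1.1 | u <- s]) = 2%N.
  by rewrite /= !inE !eqxx ![0 == _]eq_sym ?oner_eq0 ?orbT /= ?inE ?oner_eq0.
have -> : size (undup [seq u.2 | u <- s]) = 3%N.
  by rewrite /= !inE !eqxx ![0 == _]eq_sym ?oppr_eq0 ?oner_eq0 ?(negbTE neq1N1) /=.
under eq_bigr => x _ do under eq_bigr => t _ do rewrite -sum_notin.
have -> : \sum_(x : F) \sum_(t : F) \sum_(w : F)
   (w \notin [seq u.1.1 * u.2 - x * u.2 - t * u.1.1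
     | u <- s])%:R
  = \sum_(w : F) (w != 0)%:R *
      (\sum_(x : F) (x != 0)%:R *
         \sum_t (t \notin [:: 0; 1 - w - x])%:R) :> rat.
  (* Substituting x + w for x and t - w for t decouples the conditions. *)
  rewrite exchange_big /=; under eq_bigr => t _ do rewrite exchange_big /=.
  rewrite exchange_big /=; apply: eq_bigr => w _.
  rewrite exchange_big /= mulr_sumr -(sum_shift w); apply: eq_bigr => x _.
  rewrite mulrA mulr_sumr -(sum_shift (- w)); apply: eq_bigr => t _.
  rewrite -!natrM !mulnb; congr (nat_of_bool _)%:R; rewrite !inE !negb_or -!andbA.
  have -> : (w == 0 * 0 - (x + w) * 0 - (t - w) * 0) = (w == 0).
    by congr (_ == _); ring.
  have -> : (w == 1 * 1 - (x + w) * 1 - (t - w) * 1) = (t == 1 - w - x).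
    by rewrite -subr_eq0 -[RHS]subr_eq0; congr (_ == _); ring.
  have -> : (w == 1 * 0 - (x + w) * 0 - (t - w) * 1) = (t == 0).
    by rewrite -subr_eq0; congr (_ == _); ring.
  have -> : (w == 0 * (-1) - (x + w) * (-1) - (t - w) * 0) = (x == 0).
    by rewrite eq_sym -subr_eq0; congr (_ == _); ring.
  by case: (w == 0); case: (x == 0); case: (t == 0); case: (t == _).
under eq_bigr => w _.
  under eq_bigr => x _.
    rewrite sum_notin size_undup2 [0 == _]eq_sym subr_eq0 [_ == x]eq_sym; over.
  rewrite sum_neq !sumrB !sum_cst sum_delta; over.
rewrite sum_neq !(sumrB, big_split) /= !sum_cst.
have E : \sum_(w : F) (0 == 1 - w)%:R = 1 :> rat.
  by under eq_bigr => w _ do rewrite eq_sym subr_eq0 eq_sym; rewrite sum_delta.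
rewrite E subr0 eq_sym oner_eq0 /=; ring.
Qed.

(** Trace and determinant are the right coordinates: replacing t by t - x and w by w + x (t - x)
    makes t the trace and w minus the determinant of X. The first two conditions then involve only t
    and w, and the last two exclude the values w and w - t - 1 of z. *)
Lemma count_avoids_nilpotent :
  #|[set X | avoids [:: 0; 1; mx2 0 1 0 0; mx2 0 1 0 0 - 1] X]|%:R =
  q * (q ^+ 3 - 4 * q ^+ 2 + 3 * q + 2).
Proof.
have neq1N1 : 1 != -1 :> F by rewrite -subr_eq0 opprK.
pose s : seq (F * F * F) := [:: (0, 0, 0); (1, 0, 1); (0, 1, 0); (-1, 1, -1)].
have -> : [:: 0; 1; mx2 0 1 0 0; mx2 0 1 0 0 - 1] = map upper s.
  by rewrite mx2_0 mx2_1 mx2B; congr [:: _; _; _; _]; rewrite !subr0 sub0r.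
rewrite count_avoids_upper.
have -> : size (undup [seq u.1.1 | u <- s]) = 3%N.
  by rewrite /= !inE !eqxx ![0 == _]eq_sym ?oppr_eq0 ?oner_eq0 ?(negbTE neq1N1) /=.
have -> : \sum_(x : F) \sum_(t : F) \sum_(z : F | z != 0) \sum_(w : F)
   (w \notin [seq (x - u.1.1) * (t - u.2) + u.1.2 * z | u <- s])%:R
  = \sum_(x : F) \sum_(t : F) \sum_(w : F) (w != 0)%:R *
      ((w != 1 - t)%:R * \sum_(z : F) (z \notin [:: 0; w; w - t - 1])%:R) :> rat.
  apply: eq_bigr => x _; rewrite -(sum_shift (- x)); apply: eq_bigr => t _.
  rewrite exchange_big /= -(sum_shift (x * (t - x))); apply: eq_bigr => w _.
  rewrite big_mkcond !mulr_sumr; apply: eq_bigr => z _.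
  transitivity ((z != 0)%:R *
    (w + x * (t - x) \notin
      [seq (x - u.1.1) * (t - x - u.2) + u.1.2 * z | u <- s])%:R : rat).
    by case: (z == 0); rewrite /= ?mul1r ?mul0r.
  rewrite -!natrM !mulnb; congr (nat_of_bool _)%:R; rewrite !inE !negb_or.
  have -> : (w + x * (t - x) == (x - 0) * (t - x - 0) + 0 * z) = (w == 0).
    by rewrite -subr_eq0; congr (_ == _); ring.
  have -> : (w + x * (t - x) == (x - 1) * (t - x - 1) + 0 * z) = (w == 1 - t).
    by rewrite -subr_eq0 -[RHS]subr_eq0; congr (_ == _); ring.
  have -> : (w + x * (t - x) == (x - 0) * (t - x - 0) + 1 * z) = (z == w).
    by rewrite eq_sym -subr_eq0 -[RHS]subr_eq0; congr (_ == _); ring.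
  have -> : (w + x * (t - x) == (x - -1) * (t - x - -1) + 1 * z) = (z == w - t - 1).
    by rewrite eq_sym -subr_eq0 -[RHS]subr_eq0; congr (_ == _); ring.
  by case: (z == 0); case: (w == 0); case: (w == _); case: (z == w).
(* As w is nonzero, at most one coincidence occurs among 0, w and w - t - 1: either t = -1 or w = t
   + 1. *)
have E (t w : F) :
    (w != 0)%:R *
      ((w != 1 - t)%:R * \sum_(z : F) (z \notin [:: 0; w; w - t - 1])%:R) =
   (w != 0)%:R * ((w != 1 - t)%:R * (q - 3 + (t == -1)%:R + (w == t + 1)%:R)) :> rat.
  case: (eqVneq w 0) => [_|w0]; first by rewrite !mul0r.
  rewrite sum_notin size_undup3.
  have -> : (w == w - t - 1) = (t == -1).
    by rewrite eq_sym -subr_eq0 -[RHS]subr_eq0 -oppr_eq0; congr (_ == _); ring.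
  have -> : (0 == w - t - 1) = (w == t + 1).
    by rewrite eq_sym -subr_eq0 -[RHS]subr_eq0; congr (_ == _); ring.
  by rewrite [0 == w]eq_sym (negbTE w0) /=; congr (_ * (_ * _)); ring.
under eq_bigr => x _.
  under eq_bigr => t _.
    under eq_bigr => w _ do rewrite E.
    rewrite sum_neq sum_neq !big_split /= !sum_cst sum_delta.
    have -> : (0 != 1 - t) = (t != 1) by rewrite eq_sym subr_eq0 eq_sym.
    have -> : (0 == t + 1) = (t == -1) by rewrite eq_sym addr_eq0.
    have -> : (1 - t == t + 1) = (t == 0).
      rewrite eq_sym -subr_eq0 -(mulrI_eq0 t (mulfI two_neq0)); congr (_ == _); ring.
    over.
  rewrite /= !(sumrB, big_split) /= sum_neq.
  rewrite !(sumrB, big_split) /= -?mulr_sumr !sum_cst !sum_delta.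
  over.
rewrite sum_cst (negbTE neq1N1) /=; ring.
Qed.
End Counting.

(** * Normal forms up to conjugacy, and bounds on the count *)

Section Conjugation.
Variable F : finFieldType.
Local Notation q := (#|F|%:R : rat).
Implicit Types C P X : 'M[F]_2.

Definition rows2 (u w : 'rV[F]_2) : 'M[F]_2 :=
  \matrix_i (if i == 0 then u else w).

Lemma mul_rows2 (y u w : 'rV[F]_2) :
  y *m rows2 u w = y 0 0 *: u + y 0 1 *: w.
Proof.
rewrite mulmx_sum_row !big_ord_recl big_ord0 addr0 !rowK /=.
by congr (_ + y 0 _ *: _); apply: val_inj.
Qed.

(** Multiplying a relation y0 u + y1 w = 0 by C kills the w term, so y0 = 0 and then y1 = 0. *)
Lemma rows2_unit (u w : 'rV[F]_2) C :
  u *m C != 0 -> w *m C = 0 -> w != 0 -> rows2 u w \in unitmx.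
Proof.
move=> uC0 wC w0; rewrite -row_free_unit; apply: inj_row_free => y.
rewrite mul_rows2 => e.
have /eqP := congr1 (mulmx^~ C) e.
rewrite mulmxDl -!scalemxAl wC scaler0 addr0 mul0mx scaler_eq0 (negbTE uC0) orbF.
move=> /eqP y0; move/eqP: e; rewrite y0 scale0r add0r scaler_eq0 (negbTE w0) orbF.
move=> /eqP y1; apply/rowP=> j; rewrite mxE.
by case: (ord2P j) => ->.
Qed.

(** Matrices act on row vectors here: the conjugate is the matrix of y -> y C in the basis u, w. *)
Lemma rows2_similar (u w : 'rV[F]_2) C a b c d : rows2 u w \in unitmx ->
    u *m C = a *: u + b *: w -> w *m C = c *: u + d *: w ->
  rows2 u w *m C *m invmx (rows2 u w) = mx2 a b c d.
Proof.
move=> Pu uC wC; apply: (canLR (mulmxK Pu)); apply/row_matrixP=> i.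
rewrite !row_mul rowK mul_rows2 !mxE.
by case: (i == 0); rewrite ?uC ?wC.
Qed.

Lemma row_neq0 C : C != 0 -> exists i, row i C != 0.
Proof.
move=> C0; apply/existsP; apply: contraNT C0; rewrite negb_exists => /forallP r0.
by apply/eqP/row_matrixP=> i; rewrite row0; apply/eqP/negPn.
Qed.

(** The basis is a nonzero row of C, which C fixes, and a nonzero row of 1 - C, which C kills. *)
Lemma idempotent_similar C : C != 0 -> C != 1 -> C *m C = C ->
  exists2 P, P \in unitmx & P *m C *m invmx P = mx2 1 0 0 0.
Proof.
move=> /row_neq0[i u0] C1 CC.
have /row_neq0[j w0] : 1 - C != 0 by rewrite subr_eq0 eq_sym.
have uC : row i C *m C = row i C by rewrite -row_mul CC.
have wC : row j (1 - C) *m C = 0.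
  by rewrite -row_mul mulmxBl CC mul1mx subrr row0.
have Pu : rows2 (row i C) (row j (1 - C)) \in unitmx.
  by apply: (rows2_unit _ wC w0); rewrite uC.
exists (rows2 (row i C) (row j (1 - C))) => //.
by apply: rows2_similar; rewrite // ?scale1r ?scale0r ?addr0.
Qed.

(** The basis is a standard row vector whose image, a row of C, is nonzero, followed by that
    image. *)
Lemma nilpotent_similar C : C != 0 -> C *m C = 0 ->
  exists2 P, P \in unitmx & P *m C *m invmx P = mx2 0 1 0 0.
Proof.
move=> /row_neq0[i w0] CC.
have wC : row i C *m C = 0 by rewrite -row_mul CC row0.
have uC : row i 1 *m C = row i C by rewrite -row_mul mul1mx.
have Pu : rows2 (row i 1) (row i C) \in unitmx.
  by apply: (rows2_unit _ wC w0); rewrite uC.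
exists (rows2 (row i 1) (row i C)) => //.
by apply: rows2_similar; rewrite // ?scale1r ?scale0r ?addr0 ?add0r.
Qed.

Lemma card_avoids_conj P (s : seq 'M[F]_2) : P \in unitmx ->
  #|[set X | avoids [seq P *m A *m invmx P | A <- s] X]| =
  #|[set X | avoids s X]|.
Proof.
move=> Pu; pose f X := P *m X *m invmx P.
have f_inj : injective f.
  by move=> X Y /(can_inj (mulmxKV Pu)) /(can_inj (mulKmx Pu)).
rewrite -[RHS](card_imset _ f_inj); apply: eq_card => Y.
have fK X : f (invmx P *m X *m P) = X.
  by rewrite /f !mulmxA mulmxV // mul1mx mulmxK.
rewrite -(fK Y) (mem_imset _ _ f_inj) !inE /avoids all_map.
apply: eq_all => A /=; rewrite /f -mulmxBl -mulmxBr !det_mulmx det_inv mulrAC.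
by rewrite mulfV ?mul1r //; move: Pu; rewrite unitmxE unitfE.
Qed.

(** This is [phi2] for the ring M_2(F), with a pair (X, C - X) recorded by X: C - X and 1 - (C - X)
    are invertible exactly when X avoids C and C - 1. *)
Definition exceptional_count C :=
  #|[set X | avoids [:: 0; 1; C; C - 1] X]|.

Lemma exceptional_count_conj P C : P \in unitmx ->
  exceptional_count (P *m C *m invmx P) = exceptional_count C.
Proof.
move=> Pu; rewrite /exceptional_count -[RHS](card_avoids_conj _ Pu) /=.
by rewrite mulmx0 mul0mx mulmx1 mulmxV // mulmxBr mulmxBl mulmx1 mulmxV.
Qed.

Lemma exceptional_count1 :
  (exceptional_count 1)%:R = q * (q ^+ 3 - 2 * q ^+ 2 - q + 3).
Proof.
rewrite -count_avoids01; congr _%:R; apply: eq_card => X; rewrite !inE.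
by rewrite /avoids /= subrr !andbT; do 2!case: (_ != 0).
Qed.

Lemma exceptional_count_le C :
  (exceptional_count C)%:R <= q * (q ^+ 3 - 2 * q ^+ 2 - q + 3).
Proof.
rewrite -count_avoids01 ler_nat; apply/subset_leq_card/subsetP=> X.
by rewrite !inE /avoids /= => /and4P[-> ->].
Qed.

Lemma exceptional_count_le_card C : (exceptional_count C)%:R <= q ^+ 4.
Proof.
by rewrite -natrX -(card_mx F 2 2) ler_nat max_card.
Qed.

(** Translation reduces to A = 0, where [count_avoids_upper] for the one-element list of 0 counts
    the invertible matrices. *)
Lemma sum_singular (A : 'M[F]_2) :
  \sum_(X : 'M[F]_2) (\det (X - A) == 0)%:R = q ^+ 3 + q ^+ 2 - q.
Proof.
have := count_avoids_upper [:: (0, 0, 0) : F * F * F].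
rewrite count_avoids_upper_diag; last by rewrite /= eqxx.
rewrite card_indicator /avoids /= /upper /= -mx2_0.
rewrite !sum_cst => e.
have -> : \sum_(X : 'M[F]_2) (\det (X - A) == 0)%:R =
    \sum_(X : 'M[F]_2) (1 - ((\det (X - 0) != 0) && true)%:R) :> rat.
  rewrite (reindex_inj (addIr A)); apply: eq_bigr => X _.
  by rewrite addrK subr0 andbT; case: eqP => _ /=; ring.
rewrite sumrB e sumr_const (card_mx F 2 2) natrX; ring.
Qed.

Lemma exceptional_count_ge C :
  q ^+ 4 - 4 * (q ^+ 3 + q ^+ 2 - q) <= (exceptional_count C)%:R.
Proof.
rewrite card_indicator.
have -> : q ^+ 4 = \sum_(X : 'M[F]_2) 1.
  by rewrite sumr_const (card_mx F 2 2) natrX.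
have -> : 4 * (q ^+ 3 + q ^+ 2 - q) = \sum_(X : 'M[F]_2)
   ((\det (X - 0) == 0)%:R + (\det (X - 1) == 0)%:R + (\det (X - C) == 0)%:R +
     (\det (X - (C - 1)) == 0)%:R).
  by rewrite !big_split /= !sum_singular; ring.
rewrite -sumrB; apply: ler_sum => X _; rewrite /avoids /=.
by do 4!case: (_ == 0) => /=; lra.
Qed.

Section OddCharacteristic.
Hypothesis two_neq0 : 2 != 0 :> F.

Lemma exceptional_count0 :
  (exceptional_count 0)%:R = q * (q ^+ 3 - 3 * q ^+ 2 + 6).
Proof.
rewrite -(count_avoids_zero two_neq0); congr _%:R; apply: eq_card => X.
by rewrite !inE /avoids /= sub0r !andbT; do 2!case: (_ != 0).
Qed.

Lemma exceptional_count_idempotent C : C != 0 -> C != 1 -> C *m C = C ->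
  (exceptional_count C)%:R = q ^+ 4 - 4 * q ^+ 3 + 5 * q ^+ 2 - 4 * q + 4.
Proof.
move=> C0 C1 /(idempotent_similar C0 C1)[P Pu e].
by rewrite -(exceptional_count_conj _ Pu) e -count_avoids_idempotent.
Qed.

Lemma exceptional_count_nilpotent C : C != 0 -> C *m C = 0 ->
  (exceptional_count C)%:R = q * (q ^+ 3 - 4 * q ^+ 2 + 3 * q + 2).
Proof.
move=> C0 /(nilpotent_similar C0)[P Pu e].
by rewrite -(exceptional_count_conj _ Pu) e -count_avoids_nilpotent.
Qed.
End OddCharacteristic.
End Conjugation.

(** * Finite rings of odd order and sums of two squares *)

Lemma natr_card_finZmod (F : finNzRingType) : #|F|%:R = 0 :> F.
Proof.
(* Adding 1 permutes F, so the sum of all elements does not change when [#|F|] copies of 1 are added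
   to it. *)
apply: (addrI (\sum_(x : F) x)); rewrite addr0 -sumr_const -big_split /=.
by rewrite [RHS](reindex_inj (addIr 1)).
Qed.

Lemma odd_card_two_neq0 (F : finNzRingType) : odd #|F| -> 2 != 0 :> F.
Proof.
move=> oddF; apply/eqP=> two0; have /eqP := natr_card_finZmod F.
by rewrite -(odd_double_half #|F|) oddF natrD -mul2n natrM two0 mul0r addr0 oner_eq0.
Qed.

(** Pigeonhole: squaring is at most two-to-one, so the squares fill at least half of F, hence more
    than half by parity. They therefore meet their mirror image under x -> c - x. *)
Lemma sum_two_squares (F : finFieldType) (c : F) : odd #|F| ->
  exists u : F * F, u.1 ^+ 2 + u.2 ^+ 2 = c.
Proof.
move=> oddF; pose A := [set x ^+ 2 | x : F]; pose B := [set c - x | x in A].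
have cardB : #|B| = #|A| by rewrite card_imset // => x y /addrI/oppr_inj.
have cardA : (#|F| <= 2 * #|A|)%N.
  rewrite -[X in (X <= _)%N]sum1_card.
  rewrite (partition_big (fun x => x ^+ 2) [in A]) /=; last first.
    by move=> x _; apply: imset_f.
  rewrite mulnC -sum_nat_const; apply: leq_sum => _ /imsetP[y _ ->].
  rewrite sum1dep_card (leq_trans _ (_ : #|[set y; - y]| <= 2)%N) //.
    by apply/subset_leq_card/subsetP=> x; rewrite !inE eqf_sqr.
  by rewrite cards2; case: (_ != _).
have /set0Pn[_ /setIP[/imsetP[x _ ->] /imsetP[_ /imsetP[y _ ->] e]]] :
    A :&: B != set0.
  apply/eqP=> AB0; have := max_card (A :|: B).
  rewrite cardsU AB0 cards0 subn0 cardB addnn -mul2n => cardA'.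
  have /eqP E : (#|F| == 2 * #|A|)%N by rewrite eqn_leq cardA.
  by rewrite E mul2n odd_double in oddF.
by exists (x, y); rewrite /= e subrK.
Qed.

(** * Splitting of the quaternions over F *)

Section Splitting.
Variables (F : fieldType) (a b : F).
Hypothesis ab : a ^+ 2 + b ^+ 2 = -1.

(** It sends i to (a, b; b, -a), whose square is a^2 + b^2 = -1, j to (0, 1; -1, 0), and k to the
    product (-b, a; a, b) of these two. *)
Definition quat_mx (x : quaternion F) : 'M[F]_2 :=
  let: Quaternion x0 x1 x2 x3 := x in
  mx2 (x0 + x1 * a - x3 * b) (x1 * b + x2 + x3 * a)
      (x1 * b - x2 + x3 * a) (x0 - x1 * a + x3 * b).

Let bb : b * b = -1 - a * a.
Proof. by rewrite -ab; ring. Qed.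

Lemma quat_mxM x y : quat_mx (x * y) = quat_mx x *m quat_mx y.
Proof.
case: x y => [x0 x1 x2 x3] [y0 y1 y2 y3]; rewrite mx2M.
by congr mx2; rewrite /=; ring: bb.
Qed.

Lemma quat_mxB x y : quat_mx (x - y) = quat_mx x - quat_mx y.
Proof.
case: x y => [x0 x1 x2 x3] [y0 y1 y2 y3]; rewrite mx2B.
by congr mx2; rewrite /=; ring.
Qed.

Lemma quat_mx1 : quat_mx 1 = 1.
Proof. by rewrite mx2_1; congr mx2; rewrite /=; ring. Qed.

Lemma det_quat_mx x : \det (quat_mx x) = quat_norm x.
Proof. by case: x => [x0 x1 x2 x3]; rewrite det_mx2 /quat_norm /=; ring: bb. Qed.

Hypothesis two_neq0 : 2 != 0 :> F.

(** The i and k coordinates solve x1 a - x3 b = u and x1 b + x3 a = v, a linear system of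
    determinant a^2 + b^2 = -1; hence the signs. *)
Definition mx_quat (X : 'M[F]_2) : quaternion F :=
  let u := (X 0 0 - X 1 1) / 2 in let v := (X 0 1 + X 1 0) / 2 in
  Quaternion ((X 0 0 + X 1 1) / 2) (- (a * u + b * v))
    ((X 0 1 - X 1 0) / 2) (b * u - a * v).

Lemma quat_mxK : cancel quat_mx mx_quat.
Proof.
case=> [x0 x1 x2 x3]; rewrite /mx_quat !mxE /=.
by congr Quaternion; field: bb.
Qed.

Lemma mx_quatK : cancel mx_quat quat_mx.
Proof.
by move=> X; rewrite -[RHS]mx2_eta; congr mx2; field: bb.
Qed.
End Splitting.

(** * Fibres of additive surjections, and nilpotent matrices *)

Lemma card_preimage_surj (A B : finZmodType) (f : A -> B) (P : pred B) :
    {morph f : x y / x - y} -> (forall y, exists x, f x = y) ->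
  (#|[set x | P (f x)]| * #|B| = #|[set y | P y]| * #|A|)%N.
Proof.
move=> fB f_surj; pose k := #|[set x | f x == 0]|.
have f0 : f 0 = 0 by rewrite -(subrr 0) fB subrr.
have fD x y : f (x + y) = f x + f y.
  by rewrite -[y in LHS]opprK fB -sub0r fB f0 sub0r opprK.
(* The fibre over [f x0] is the kernel translated by [x0]. *)
have fiber y : #|[set x | f x == y]| = k.
  have [x0 <-] := f_surj y.
  rewrite /k -[RHS](card_imset _ (addIr x0)); apply: eq_card => x.
  rewrite inE; apply/eqP/imsetP => [e|[z]]; last first.
    by rewrite inE => /eqP fz ->; rewrite fD fz add0r.
  by exists (x - x0); rewrite ?subrK // inE fB e subrr.
have count (Q : pred B) : (#|[set x | Q (f x)]| = #|[set y | Q y]| * k)%N.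
  rewrite -sum1_card (partition_big f [in [set y | Q y]]) /=; last first.
    by move=> x; rewrite !inE.
  rewrite -sum_nat_const; apply: eq_bigr => y; rewrite inE => Qy.
  rewrite -(fiber y) sum1dep_card; apply: eq_card => x; rewrite !inE.
  by case: eqP => [->|]; rewrite ?Qy ?andbF.
have cardA : #|A| = (#|B| * k)%N by have := count xpredT; rewrite !cardsE.
by rewrite (count P) cardA mulnAC mulnA.
Qed.

(** A nilpotent matrix has determinant 0, so C^2 = t C with t the trace, and C^(m+1) = t^m C; hence
    t = 0 or C = 0. *)
Lemma nilpotent_sqr0 (F : fieldType) (C : 'M[F]_2) k : C ^+ k = 0 -> C *m C = 0.
Proof.
move=> Ck; have detC : C 0 0 * C 1 1 - C 0 1 * C 1 0 = 0.
  apply/eqP; rewrite -det_mx2 mx2_eta; apply/negPn/negP => detC.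
  have : C ^+ k \is a GRing.unit.
    by apply: unitrX; rewrite -[_ \is a _]/(C \in unitmx) unitmxE unitfE.
  by rewrite Ck unitr0.
pose t := C 0 0 + C 1 1.
(* Cayley-Hamilton with vanishing determinant. *)
have CC : C * C = t *: C.
    rewrite -[C * C]/(C *m C) -[in LHS](mx2_eta C) mx2M.
  have {}detC : C 0 1 * C 1 0 = C 0 0 * C 1 1.
    by apply/esym/eqP; rewrite -subr_eq0 detC.
  by apply: eq_mx2; rewrite !mxE /= /t; ring: detC.
have CX m : C ^+ m.+1 = t ^+ m *: C.
  by elim: m => [|m IH]; rewrite ?scale1r // exprS IH -scalerAr CC scalerA exprSr.
case: k Ck => [/eqP|k]; first by rewrite oner_eq0.
rewrite CX => /eqP; rewrite scaler_eq0 expf_eq0 => /orP[/andP[_ /eqP t0]|/eqP->].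
  by rewrite -[C *m C]/(C * C) CC t0 scale0r.
exact: mul0mx.
Qed.

Lemma det_subC (F : comNzRingType) (A B : 'M[F]_2) : \det (A - B) = \det (B - A).
Proof. by rewrite -opprB -scaleN1r detZ sqrrN expr1n mul1r. Qed.

(** * The reduction map from H(R) to M_2(F) *)

Section Transfer.
Variables (R : finComNzRingType) (F : finFieldType) (f : {rmorphism R -> F}).
Hypothesis f_surj : forall y, exists x, f x = y.
Hypothesis f_local : forall x, f x != 0 -> exists y, y * x = 1.
Hypothesis f_ker : forall x, f x = 0 -> x \in jacobson R.
Variables (a b : F).
Hypothesis ab : a ^+ 2 + b ^+ 2 = -1.
Hypothesis two_neq0 : 2 != 0 :> F.
Local Notation H := (quaternion R).

Definition quat_red (x : H) : 'M[F]_2 :=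
  quat_mx a b (Quaternion (f (quat_re x)) (f (quat_i x))
                          (f (quat_j x)) (f (quat_k x))).

Lemma quat_redM x y : quat_red (x * y) = quat_red x *m quat_red y.
Proof.
rewrite /quat_red -quat_mxM //; congr (quat_mx _ _ _).
case: x y => [????] [????]; congr Quaternion; rewrite /=;
  by rewrite !(rmorphD, rmorphN, rmorphM).
Qed.

Lemma quat_redB : {morph quat_red : x y / x - y}.
Proof.
move=> x y; rewrite /quat_red -quat_mxB; congr (quat_mx _ _ _).
by congr Quaternion; rewrite /= rmorphB.
Qed.

Lemma quat_red1 : quat_red 1 = 1.
Proof.
rewrite -(quat_mx1 a b); congr (quat_mx _ _ _).
by congr Quaternion; rewrite ?rmorph0 ?rmorph1.
Qed.

Lemma quat_redX x k : quat_red (x ^+ k) = quat_red x ^+ k.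
Proof.
by elim: k => [|k IH]; rewrite ?expr0 ?quat_red1 // !exprS quat_redM IH.
Qed.

Lemma quat_red_surj X : exists x, quat_red x = X.
Proof.
have [x0 e0] := f_surj (quat_re (mx_quat a b X)).
have [x1 e1] := f_surj (quat_i (mx_quat a b X)).
have [x2 e2] := f_surj (quat_j (mx_quat a b X)).
have [x3 e3] := f_surj (quat_k (mx_quat a b X)).
exists (Quaternion x0 x1 x2 x3).
by rewrite /quat_red /= e0 e1 e2 e3; apply: mx_quatK.
Qed.

Lemma det_quat_red x : \det (quat_red x) = f (quat_norm x).
Proof.
by rewrite det_quat_mx // /quat_norm /= !rmorphD !rmorphXn.
Qed.

(** The determinant is the image of the norm. If it is nonzero, the norm has an inverse y in R, and
    y times the conjugate of x inverts x on both sides. *)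
Lemma quat_unitE (x : H) : (x \is a GRing.unit) = (\det (quat_red x) != 0).
Proof.
apply/idP/idP => [ux|].
  have := congr1 quat_red (mulrV ux); rewrite quat_redM quat_red1.
  move/(congr1 determinant); rewrite det_mulmx det1 => e; apply/eqP=> d0.
  by move/eqP: e; rewrite d0 mul0r eq_sym oner_eq0.
rewrite det_quat_red => /f_local[y yN].
have e1 : y *: quat_conj x * x = 1.
  by rewrite -scalerAl quat_conj_mul scalerA yN scale1r.
have e2 : x * (y *: quat_conj x) = 1.
  rewrite -scalerAr (_ : x * quat_conj x = (quat_norm x)%:A) ?scalerA ?yN ?scale1r //.
  by case: (x) => [????]; congr Quaternion; rewrite /quat_norm /=; ring.
by apply/unitrP; exists (y *: quat_conj x).
Qed.

(** Pairs of sum c are recorded by their first entry, units are read off the reduction, and its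
    fibres have equal size. The identity is cross-multiplied to stay in [nat]. *)
Lemma phi2_exceptional_count (c : H) :
  (phi2 c * #|F| ^ 4 = exceptional_count (quat_red c) * #|R| ^ 4)%N.
Proof.
have cardH : #|{: H}| = (#|R| ^ 4)%N.
  rewrite (bij_eq_card (f := @tuple_of_quat R)) ?card_prod.
    by rewrite !expnS expn0 !mulnA muln1.
  by exists (@quat_of_tuple R); [exact: tuple_of_quatK | case=> [[[??]?]?]].
have cardM : #|{: 'M[F]_2}| = (#|F| ^ 4)%N by rewrite card_mx.
rewrite -cardH -cardM -(card_preimage_surj _ quat_redB quat_red_surj).
congr (_ * _)%N; rewrite /phi2.
pose g (x : H) := (x, c - x).
have g_inj : injective g by move=> x y [].
rewrite -[RHS](card_imset _ g_inj); apply: eq_card => -[x y].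
have exc_avoids z : exceptional_unit z && exceptional_unit (c - z) =
    avoids [:: 0; 1; quat_red c; quat_red c - 1] (quat_red z).
  rewrite /exceptional_unit !quat_unitE !quat_redB quat_red1 /avoids /= subr0.
  rewrite (det_subC (quat_red z) 1) (det_subC (quat_red z) (quat_red c)) !andbA andbT.
  by congr (_ && (\det _ != 0)); rewrite !opprB addrCA.
rewrite inE /=; apply/and3P/imsetP => [[ex ey /eqP e]|[z]].
  have yE : y = c - x by rewrite -e addrC addKr.
  by exists x; rewrite /g -?yE // inE -[X in is_true X]exc_avoids -yE ex.
rewrite inE -[X in is_true X -> _]exc_avoids => /andP[ez ecz] [-> ->].
by split; rewrite // addrC subrK.
Qed.

(** J(H(R)) is a proper two-sided ideal, so the real part of any of its elements reduces to 0:
    otherwise 4 times that part would be a unit in the ideal. The other coordinates of c are the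
    real parts of -ic, -jc and -kc. Conversely, J(R) H(R) lies in J(H(R)). *)
Lemma jproj_quat_eq0 (c : H) : (jproj c == 0) = (quat_red c == 0).
Proof.
rewrite -[0 in LHS](rmorph0 (@jproj H)) jproj_eq subr0.
apply/idP/eqP => [Jc|c0].
  have Jre (x : H) : x \in jacobson H -> f (quat_re x) = 0.
    move=> Jx; apply/eqP/negPn/negP => fx.
    have fx4 : f (2 * 2 * quat_re x) != 0.
      by rewrite !rmorphM !rmorph_nat !mulf_neq0.
    have [y ey] := f_local fx4.
    (* x - ixi - jxj - kxk is four times the real part of x. *)
    have : y%:A * (x - quatI * x * quatI - quatJ * x * quatJ - quatK * x * quatK)
       \in jacobson H.
      by rewrite idealMr // !rpredB // jacobsonMr // idealMr.
    rewrite (_ : _ * _ = 1) ?idealr1 //.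
    case: x ey {Jx fx fx4} => [x0 x1 x2 x3] /= ey.
    congr Quaternion; rewrite /=; [| ring | ring | ring].
    by transitivity (y * (2 * 2 * x0)); [ring | exact: ey].
  rewrite /quat_red; have -> : quat_i c = quat_re (- (quatI * c)).
    by case: (c) => [????] /=; ring.
  have -> : quat_j c = quat_re (- (quatJ * c)) by case: (c) => [????] /=; ring.
  have -> : quat_k c = quat_re (- (quatK * c)) by case: (c) => [????] /=; ring.
  rewrite !Jre ?rpredN ?idealMr // mx2_0; congr mx2; rewrite /=; ring.
have : mx_quat a b (quat_red c) = 0.
  by rewrite c0 /mx_quat !mxE; congr Quaternion; rewrite /=; ring.
rewrite quat_mxK // => -[c0' c1 c2 c3].
case: c {c0} c0' c1 c2 c3 => [x0 x1 x2 x3] /= /f_ker J0 /f_ker J1 /f_ker J2 /f_ker J3.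
by rewrite quat_basis !rpredD // jacobson_quaternion.
Qed.
End Transfer.

(** * The residue field of R *)

Lemma residue_local (R : finComNzRingType) (x : R) :
  GRing.field_axiom (jquot R) -> jproj x != 0 -> exists y, y * x = 1.
Proof.
move=> Fax /Fax /unitrP[z [zx _]]; have [w ew] := jprojP z.
(* As w inverts x modulo J(R), the product w x is 1 minus an element of J(R), hence invertible. *)
have : 1 - w * x \in jacobson R.
  by rewrite -jproj_eq rmorphM rmorph1 /= -ew zx.
by move=> /jacobson_unit[v]; rewrite opprB addrC subrK mulrA => e; exists (v * w).
Qed.

(** F is [jquot R] with its field structure; it is hidden behind an existential so that only these
    properties of [red] are used afterwards. *)
Lemma residue_reduction (R : finComNzRingType) :
    GRing.field_axiom (jquot R) -> odd #|{: jquot R}| ->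
  exists (F : finFieldType) (red : quaternion R -> 'M[F]_2),
  [/\ #|F| = #|{: jquot R}|, 2 != 0 :> F,
      forall c, (phi2 c * #|F| ^ 4 = exceptional_count (red c) * #|R| ^ 4)%N,
      forall c, (jproj c == 0) = (red c == 0)
    & [/\ red 1 = 1, {morph red : x y / x - y},
      {morph red : x y / x * y >-> x *m y} & forall x k, red (x ^+ k) = red x ^+ k]].
Proof.
move=> Fax oddF.
pose F : finFieldType :=
  HB.pack (jquot R) (GRing.ComUnitRing_isField.Build (jquot R) Fax).
pose f : {rmorphism R -> F} := @jproj R : {rmorphism R -> jquot R}.
have two_neq0 : 2 != 0 :> F by apply: odd_card_two_neq0.
have [[a b] /= ab] := @sum_two_squares F (-1) oddF.
have f_surj y : exists x, f x = y by have [x ->] := jprojP y; exists x.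
have f_local x : f x != 0 -> exists y, y * x = 1 by apply: residue_local.
have f_ker x : f x = 0 -> x \in jacobson R.
  by move/eqP; rewrite -(rmorph0 (@jproj R)) [_ == _]jproj_eq subr0.
exists F, (quat_red f a b); split=> // [c|c|].
- exact: phi2_exceptional_count.
- exact: jproj_quat_eq0.
split; [exact: quat_red1 | exact: quat_redB | exact: quat_redM | exact: quat_redX].
Qed.

Theorem theorem4p9 (p n r : nat) (R : finComNzRingType) (c : quaternion R) :
  prime p -> (2 < p)%N -> (0 < n)%N -> (0 < r)%N ->
  local_ring R -> #|R| = (p ^ (n * r))%N ->
  GRing.field_axiom (jquot R) -> #|{: jquot R}| = (p ^ r)%N ->
  let cbar : jquot (quaternion R) := jproj c in
  let phi : rat := (phi2 c)%:R in
  let P (k : nat) : rat := p%:R ^+ k in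
  [/\ cbar = 0 ->
        phi = P ((4 * n - 3) * r)%N
              * (P (3 * r)%N - 3%:R * P (2 * r)%N + 6%:R),
      cbar = 1 ->
        phi = P ((4 * n - 3) * r)%N
              * (P (3 * r)%N - 2%:R * P (2 * r)%N - P r + 3%:R),
      cbar != 0 -> cbar != 1 -> cbar ^+ 2 = cbar ->
        phi = P (4 * (n - 1) * r)%N
              * (P (4 * r)%N - 4%:R * P (3 * r)%N + 5%:R * P (2 * r)%N
                 - 4%:R * P r + 4%:R)
    & cbar != 0 -> (exists k : nat, cbar ^+ k = 0) ->
        phi = P ((4 * n - 3) * r)%N
              * (P (3 * r)%N - 4%:R * P (2 * r)%N + 3%:R * P r + 2%:R)]
  /\ (c \is a GRing.unit ->
        phi <= P ((4 * n - 3) * r)%N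
               * (P (3 * r)%N - 2%:R * P (2 * r)%N - P r + 3%:R))
  /\ ((9 <= p ^ r)%N ->
        P ((4 * n - 1) * r)%N * (P r - 8%:R) <= phi
        /\ ((exists lambda : jquot R,
               [/\ lambda != 0, lambda != 1 & cbar ^+ 2 = lambda *: cbar]) ->
            phi <= P ((4 * n - 3) * r)%N / (P r - 8%:R)
                   * (P (4 * r)%N - 4%:R * P (3 * r)%N + 5%:R * P (2 * r)%N
                      - 4%:R * P r + 4%:R))).
Proof.
move=> p_pr p_gt2 n_gt0 r_gt0 _ cardR Fax cardF cbar phi P.
have oddF : odd #|{: jquot R}|.
  have [p2|p_odd] := even_prime p_pr; first by rewrite p2 in p_gt2.
  by rewrite cardF oddX p_odd orbT.
have [F [red [cardFR two_neq0 phi_red red_eq0 [red1 redB redM redX]]]] :=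
  residue_reduction Fax oddF.
set C := red c.
pose q : rat := P r.
have PE k : P (k * r)%N = q ^+ k by rewrite /q /P -exprM mulnC.
have qE : q = #|F|%:R by rewrite cardFR cardF natrX.
have q_gt2 : 3 <= q.
  rewrite qE cardFR cardF ler_nat (leq_trans p_gt2) //.
  by rewrite -[X in (X <= _)%N]expn1 leq_pexp2l // prime_gt0.
have q_neq0 : q != 0 by rewrite gt_eqF // (lt_le_trans _ q_gt2).
(* Here [#|R|] is q^n, and q^4 is cancelled; since n > 0, the exponent 4 (n - 1) + 4 is 4 n. *)
have phiE : phi = q ^+ (4 * (n - 1)) * (exceptional_count C)%:R.
  apply: (mulIf (expf_neq0 4 q_neq0)).
  have := congr1 (fun k => k%:R : rat) (phi_red c).
  rewrite cardR !natrM !natrX -qE => ->; have -> : p%:R ^+ (n * r) = q ^+ n := PE n.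
  rewrite -!exprD mulrAC -exprD mulrC; congr (_ ^+ _ * _); lia.
(* The common factor q^(4(n-1)) is extracted, leaving inequalities and identities about the count
   over F alone. *)
have P3 : P ((4 * n - 3) * r)%N = q ^+ (4 * (n - 1)) * q.
  by rewrite PE -exprSr; congr (_ ^+ _); lia.
have P1 : P ((4 * n - 1) * r)%N = q ^+ (4 * (n - 1)) * q ^+ 3.
  by rewrite PE -exprD; congr (_ ^+ _); lia.
rewrite P1 P3 !PE -/q phiE -!mulrA.
have Q0 : 0 <= q ^+ (4 * (n - 1)) by rewrite exprn_ge0 // (le_trans _ q_gt2).
have cbar1 : cbar = 1 -> C = 1.
  move=> /eqP c1; apply/eqP; rewrite -subr_eq0 -red1 -redB -red_eq0.
  by rewrite rmorphB rmorph1 subr_eq0.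
have cbar0 : (cbar == 0) = (C == 0) by exact: red_eq0.
split; [split | split].
- move=> /eqP; rewrite cbar0 => /eqP->.
  by rewrite exceptional_count0 // -qE.
- by move=> /cbar1 ->; rewrite exceptional_count1 -qE.
- rewrite cbar0 => C0 c1 cc.
  rewrite (exceptional_count_idempotent _ C0) -?qE //.
    apply: contraNneq c1 => C1; rewrite -subr_eq0 -(rmorph1 (@jproj _)) -rmorphB.
    by rewrite red_eq0 redB red1 -/C C1 subrr.
  apply/eqP; rewrite -subr_eq0 -redM -redB -red_eq0 rmorphB rmorphM subr_eq0.
  by rewrite -expr2 cc.
- rewrite cbar0 => C0 [k ck].
  rewrite (exceptional_count_nilpotent two_neq0 C0) -?qE //.
  apply: (@nilpotent_sqr0 _ _ k); apply/eqP; rewrite -redX -red_eq0 rmorphXn.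
  by rewrite -/cbar ck.
- by move=> _; rewrite ler_wpM2l // qE exceptional_count_le.
move=> q_ge9; have {}q_ge9 : 9 <= q by rewrite qE cardFR cardF ler_nat.
split=> [|_].
  (* The union bound exceeds q^3 (q - 8) by 4 q (q^2 - q + 1). *)
  rewrite ler_wpM2l //; apply: le_trans (exceptional_count_ge C); rewrite -qE.
  nra.
rewrite ler_wpM2l // (le_trans (exceptional_count_le_card C)) // -qE.
have q0 : 0 <= q by apply: le_trans q_ge9.
rewrite mulrCA ler_pdivlMl ?subr_gt0 ?(lt_le_trans _ q_ge9) //.
(* After multiplication by q - 8 > 0, the bound q^4 leaves the gap q (4 q^3 + 5 q^2 - 4 q + 4),
   rewritten with a square to make its sign visible. *)
rewrite -subr_ge0 (_ : _ - _ = q * (4 * q ^+ 3 + q ^+ 2 + (2 * q - 1) ^+ 2 + 3)).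
  by rewrite !(sqr_ge0, mulr_ge0, addr_ge0, exprn_ge0).
by ring.
Qed.
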